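(* Let $\mathbf M$ be a cyclic pointed residuated $\mathbf S$-bimodule with point $0$, and let $\mathbf N$ be either the Nagata product $\mathbf S\ltimes\mathbf M$ or the restricted Nagata product $(\mathbf S\ltimes\mathbf M)_0$. Let $N_\sigma=\sigma[N]$ (a subposemigroup of $\mathbf N$) and $N_\gamma=\gamma[N]$ (with the inherited order). Then $N_\gamma$ is a join semilattice and is an $N_\sigma$-bimodule, pointed by $e_M(0)$, under the actions $a*x=\gamma(a\circ x)$, $x*a=\gamma(x\circ a)$ ($a\in N_\sigma$, $x\in N_\gamma$), residuated with residuals $x\backslash_r y=\sigma(x\backslash y)$, $a\backslash_\ell x=\gamma(a\backslash x)$, $y/_\ell x=\sigma(y/x)$, $x/_r a=\gamma(x/a)$ (where the residuals $m\backslash n$, $n/m$ in $\mathbf N$ exist for $n\in N_\gamma$); and the pair $\langle e_S,e_M\rangle$ is an isomorphism from the $0$-pointed $\mathbf S$-bimodule $\mathbf M$ onto this $e_M(0)$-pointed $N_\sigma$-bimodule $N_\gamma$.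
   Context: A posemigroup is a poset with an isotone associative multiplication. Let $\mathbf S$ be a posemigroup and $\mathbf M=\langle M,\vee\rangle$ a join semilattice; elements of $S$ are written $a,b$ and of $M$ written $x,y$. A residuated $\mathbf S$-bimodule is given by isotone actions $a*x\in M$, $x*a\in M$ with $(ab)*x=a*(b*x)$, $x*(ab)=(x*a)*b$, $(a*x)*b=a*(x*b)$, distributing over $\vee$ in $M$, and maps $\backslash_\ell:S\times M\to M$, $/_\ell:M\times M\to S$, $\backslash_r:M\times M\to S$, $/_r:M\times S\to M$ with $x\le a\backslash_\ell y\iff a*x\le y\iff a\le y/_\ell x$ and $x\le y/_r a\iff x*a\le y\iff a\le x\backslash_r y$. Cyclic pointed: a constant $0\in M$ with $a*0=0*a$ for all $a$. An isomorphism of pointed residuated bimodules is a pair of bijections (a posemigroup isomorphism on scalars and a join-semilattice isomorphism on modules) preserving the actions, the four residuals, and the point. The Nagata product $\mathbf S\ltimes\mathbf M$ is $S\times M$ with componentwise order and $\langle a,x\rangle\circ\langle b,y\rangle=\langle a\cdot b,x*b\vee a*y\rangle$; the restricted Nagata product is its subposemigroup on $\{\langle a,x\rangle:0*a\le x,a*0\le x\}$. Define $\sigma\langle a,x\rangle=\langle a,a*0\rangle$, $\gamma\langle a,x\rangle=\langle 0\backslash_r x,x\rangle$, $e_S(a)=\langle a,a*0\rangle$, $e_M(x)=\langle 0\backslash_r x,x\rangle$. *)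

(* Defs.v *)
From HB Require Import structures.
From mathcomp Require Import all_boot all_order.
From mathcomp Require Import boolp classical_sets.

Set Implicit Arguments.
Unset Strict Implicit.
Unset Printing Implicit Defensive.

Import Order.TTheory.
Local Open Scope classical_set_scope.
Local Open Scope order_scope.

(* A subset, seen as a type, carries the inherited order. *)
HB.instance Definition _ d (T : porderType d) (A : set T) :=
  SubChoice.copy (set_type A) {x : T | x \in A}.
HB.instance Definition _ d (T : porderType d) (A : set T) :=
  [SubChoice_isSubPOrder of set_type A by <: with d].

(* The multiplication (resp. join) is an explicit argument, so that being a
   posemigroup (resp. a join semilattice) can be asserted of a given poset. *)
Record is_posemigroup d (S : porderType d) (mul : S -> S -> S) : Prop := {
  posemigroup_mulA : associative mul;
  posemigroup_isotone : forall a b c e : S,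
    a <= b -> c <= e -> mul a c <= mul b e
}.

Definition is_join_semilattice d (M : porderType d) (join : M -> M -> M) : Prop :=
  forall x y z : M, (join x y <= z) = (x <= z) && (y <= z).

(* Data of a pointed residuated bimodule:
     lact a x = a * x           ract x a = x * a
     lresM a y = a \_l y        lresS y x = y /_l x
     rresS x y = x \_r y        rresM y a = y /_r a      *)
Record bimodule_ops (S M : Type) := BimoduleOps {
  lact : S -> M -> M;
  ract : M -> S -> M;
  lresM : S -> M -> M;
  lresS : M -> M -> S;
  rresS : M -> M -> S;
  rresM : M -> S -> M;
  bpoint : M
}.

Record is_residuated_bimodule dS (S : porderType dS) (mul : S -> S -> S)
    dM (M : porderType dM) (join : M -> M -> M)
    (B : bimodule_ops S M) : Prop := {
  lact_isotone : forall (a b : S) (x y : M),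
    a <= b -> x <= y -> lact B a x <= lact B b y;
  ract_isotone : forall (a b : S) (x y : M),
    a <= b -> x <= y -> ract B x a <= ract B y b;
  lactA : forall (a b : S) (x : M), lact B (mul a b) x = lact B a (lact B b x);
  ractA : forall (a b : S) (x : M), ract B x (mul a b) = ract B (ract B x a) b;
  lractA : forall (a b : S) (x : M), ract B (lact B a x) b = lact B a (ract B x b);
  lactU : forall (a : S) (x y : M),
    lact B a (join x y) = join (lact B a x) (lact B a y);
  ractU : forall (a : S) (x y : M),
    ract B (join x y) a = join (ract B x a) (ract B y a);
  lresMP : forall (a : S) (x y : M), (x <= lresM B a y) = (lact B a x <= y);
  lresSP : forall (a : S) (x y : M), (a <= lresS B y x) = (lact B a x <= y);
  rresMP : forall (a : S) (x y : M), (x <= rresM B y a) = (ract B x a <= y);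
  rresSP : forall (a : S) (x y : M), (a <= rresS B x y) = (ract B x a <= y)
}.

Definition is_cyclic (S M : Type) (B : bimodule_ops S M) : Prop :=
  forall a : S, lact B a (bpoint B) = ract B (bpoint B) a.

(* A bijection preserving joins is an isomorphism of join semilattices, hence
   also of the underlying posets; on scalars the order has to be mentioned. *)
Record is_bimodule_iso
    dS (S : porderType dS) (mul : S -> S -> S)
    dM (M : porderType dM) (join : M -> M -> M) (B : bimodule_ops S M)
    dS' (S' : porderType dS') (mul' : S' -> S' -> S')
    dM' (M' : porderType dM') (join' : M' -> M' -> M') (B' : bimodule_ops S' M')
    (f : S -> S') (g : M -> M') : Prop := {
  iso_scalar_bij : bijective f;
  iso_scalar_le : forall a b : S, (f a <= f b) = (a <= b);
  iso_scalar_mul : forall a b : S, f (mul a b) = mul' (f a) (f b);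
  iso_module_bij : bijective g;
  iso_module_join : forall x y : M, g (join x y) = join' (g x) (g y);
  iso_lact : forall (a : S) (x : M), g (lact B a x) = lact B' (f a) (g x);
  iso_ract : forall (a : S) (x : M), g (ract B x a) = ract B' (g x) (f a);
  iso_lresM : forall (a : S) (x : M), g (lresM B a x) = lresM B' (f a) (g x);
  iso_lresS : forall x y : M, f (lresS B y x) = lresS B' (g y) (g x);
  iso_rresS : forall x y : M, f (rresS B x y) = rresS B' (g x) (g y);
  iso_rresM : forall (a : S) (x : M), g (rresM B x a) = rresM B' (g x) (f a);
  iso_point : g (bpoint B) = bpoint B'
}.

Section Nagata.
Context dS (S : porderType dS) (mul : S -> S -> S).
Context dM (M : joinSemilatticeType dM) (B : bimodule_ops S M).

(* [S *p M] is [S * M] with the componentwise order. *)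
Definition nagata_mul (p q : S *p M) : S *p M :=
  (mul p.1 q.1, ract B p.2 q.1 `|` lact B p.1 q.2).

Definition nagata : set (S *p M) := setT.

Definition restricted_nagata : set (S *p M) :=
  [set p | ract B (bpoint B) p.1 <= p.2 /\ lact B p.1 (bpoint B) <= p.2].

Definition nagata_eS (a : S) : S *p M := (a, lact B a (bpoint B)).
Definition nagata_eM (x : M) : S *p M := (rresS B (bpoint B) x, x).
Definition nagata_sigma (p : S *p M) : S *p M := (p.1, lact B p.1 (bpoint B)).
Definition nagata_gamma (p : S *p M) : S *p M := (rresS B (bpoint B) p.2, p.2).

(* [r] is the residual m\n, resp. n/m, computed in the subset [N]. *)
Definition is_nagata_under (N : set (S *p M)) (m n r : S *p M) : Prop :=
  N r /\ forall p, N p -> (p <= r) = (nagata_mul m p <= n).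
Definition is_nagata_over (N : set (S *p M)) (n m r : S *p M) : Prop :=
  N r /\ forall p, N p -> (p <= r) = (nagata_mul p m <= n).

End Nagata.

Arguments nagata {dS} S {dM} M.

(* Main.v *)
Require Import Defs.
From mathcomp Require Import all_boot all_order.
From mathcomp Require Import boolp classical_sets.
Import Order.TTheory.
Local Open Scope classical_set_scope.
Local Open Scope order_scope.

(** In [N] the residuals with numerator [n = gamma n] exist because [0] is cyclic:
    [(a, x) o (c, z) <= n] says that [a * z <= y], [x * c <= y] and
    [0 * (a c) = (a * 0) * c <= y], and the last two conditions combine into
    [(x \/ a * 0) * c <= y]. Both [e_S] and [e_M] are order isomorphisms onto
    [N_sigma] and [N_gamma], with the coordinate projections as inverses, so the
    bimodule structure can be transported along them; it then remains to see
    that the transported operations are the ones computed in [N]. *)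

Section Transport.
Context {dS} {S : porderType dS} {dS'} {S' : porderType dS'}.
Context {dM} {M : porderType dM} {dM'} {M' : porderType dM'}.
Context (f : S -> S') (f' : S' -> S) (g : M -> M') (g' : M' -> M).
Context (fK : cancel f f') (f'K : cancel f' f) (gK : cancel g g') (g'K : cancel g' g).
Context (f_le : {mono f : a b / a <= b}) (g_le : {mono g : x y / x <= y}).
Context (mul : S -> S -> S) (join : M -> M -> M) (B : bimodule_ops S M).

Definition transport_bimodule : bimodule_ops S' M' := {|
  lact a x := g (lact B (f' a) (g' x));
  ract x a := g (ract B (g' x) (f' a));
  lresM a x := g (lresM B (f' a) (g' x));
  lresS y x := f (lresS B (g' y) (g' x));
  rresS x y := f (rresS B (g' x) (g' y));
  rresM x a := g (rresM B (g' x) (f' a));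
  bpoint := g (bpoint B)
|}.

Let transport_mul (a b : S') := f (mul (f' a) (f' b)).
Let transport_join (x y : M') := g (join (g' x) (g' y)).

Lemma transport_posemigroup : is_posemigroup mul -> is_posemigroup transport_mul.
Proof.
case=> mulA mul_le; split=> [a b c|a b c e]; rewrite /transport_mul.
  by rewrite !fK mulA.
rewrite -[a]f'K -[b]f'K -[c]f'K -[e]f'K !f_le !fK; exact: mul_le.
Qed.

Lemma transport_join_semilattice :
  is_join_semilattice join -> is_join_semilattice transport_join.
Proof.
move=> joinP x y z; rewrite /transport_join.
by rewrite -[x]g'K -[y]g'K -[z]g'K !g_le !gK joinP.
Qed.

Lemma transport_residuated_bimodule :
  is_residuated_bimodule mul join B ->
  is_residuated_bimodule transport_mul transport_join transport_bimodule.
Proof.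
rewrite /transport_mul /transport_join.
case=> l_le r_le lA rA lrA lU rU lM lS rM rS; split=> /=.
- move=> a b x y; rewrite -[a]f'K -[b]f'K -[x]g'K -[y]g'K.
  by rewrite f_le !g_le !fK !gK; apply: l_le.
- move=> a b x y; rewrite -[a]f'K -[b]f'K -[x]g'K -[y]g'K.
  by rewrite f_le !g_le !fK !gK; apply: r_le.
- by move=> a b x; rewrite fK gK lA.
- by move=> a b x; rewrite fK gK rA.
- by move=> a b x; rewrite !gK lrA.
- by move=> a x y; rewrite !gK lU.
- by move=> a x y; rewrite !gK rU.
(* Only the bare sides of the two inequalities are written as images under [f] or [g], so that both
   inequalities descend to the original adjunction. *)
- by move=> a x y; rewrite -{1}[x]g'K -{2}[y]g'K !g_le lM.
- by move=> a x y; rewrite -{1}[a]f'K -{2}[y]g'K f_le g_le lS.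
- by move=> a x y; rewrite -{1}[x]g'K -{2}[y]g'K !g_le rM.
- by move=> a x y; rewrite -{1}[a]f'K -{2}[y]g'K f_le g_le rS.
Qed.

Lemma transport_bimodule_iso :
  is_bimodule_iso mul join B transport_mul transport_join transport_bimodule f g.
Proof.
rewrite /transport_mul /transport_join.
split=> //=; try by move=> *; rewrite ?fK ?gK.
- by exists f'.
- by exists g'.
Qed.

End Transport.

Section NagataResiduals.

Set Implicit Arguments.

Context {dS} {S : porderType dS} (mul : S -> S -> S).
Context {dM} {M : joinSemilatticeType dM} (B : bimodule_ops S M).
Context (hB : is_residuated_bimodule mul (@Order.join dM M) B) (hcyc : is_cyclic B).
Context (N : set (S *p M)) (hN : N = nagata S M \/ N = restricted_nagata B).
Local Notation "0" := (bpoint B).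

(** For a numerator fixed by [gamma]: the largest [c] with [(x \/ a * 0) * c <= y], paired with the
    largest [z] with [a * z <= y], where [m = (a, x)] and [y = n.2]. *)
Definition nagata_under (m n : S *p M) : S *p M :=
  (rresS B (m.2 `|` lact B m.1 0) n.2, lresM B m.1 n.2).

(** Mirror image: [0 * (c a) = c * (a * 0)] by cyclicity, so this condition and [c * x <= y] combine
    into [c * (x \/ a * 0) <= y]. *)
Definition nagata_over (n m : S *p M) : S *p M :=
  (lresS B n.2 (m.2 `|` lact B m.1 0), rresM B n.2 m.1).

Lemma ract_rresS (x y : M) : ract B x (rresS B x y) <= y.
Proof. by rewrite -(rresSP hB). Qed.

Lemma lact_lresS (x y : M) : lact B (lresS B y x) x <= y.
Proof. by rewrite -(lresSP hB). Qed.

Lemma lact_rresS_point (x : M) : lact B (rresS B 0 x) 0 <= x.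
Proof. by rewrite hcyc ract_rresS. Qed.

Lemma ract_lact_point (a c : S) : ract B (lact B a 0) c = lact B (mul a c) 0.
Proof. by rewrite (lractA hB) -hcyc (lactA hB). Qed.

(** By cyclicity the two inequalities defining the restricted product coincide; this treats both
    choices of [N] at once. *)
Lemma mem_nagata (p : S *p M) : lact B p.1 0 <= p.2 -> N p.
Proof. by case: hN => -> // h; split; rewrite // -hcyc. Qed.

Lemma nagata_underP (m n : S *p M) :
  n.1 = rresS B 0 n.2 -> is_nagata_under mul B N m n (nagata_under m n).
Proof.
case: m n => a x [_ y] /= ->; split=> [|[c z] _].
  (* With [r] the first coordinate of the residual, membership amounts to [(a * 0) * r <= y], which
     follows from [(x \/ a * 0) * r <= y]. *)
  apply: mem_nagata; rewrite /= hcyc (lresMP hB) -(lractA hB).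
  by apply: le_trans (ract_rresS (x `|` lact B a 0) y); rewrite (ractU hB) leUr.
rewrite !leEprod /= (rresSP hB) (lresMP hB) (rresSP hB) (ractU hB) !leUx.
by rewrite ract_lact_point hcyc -andbA andbCA.
Qed.

Lemma nagata_overP (m n : S *p M) :
  n.1 = rresS B 0 n.2 -> is_nagata_over mul B N n m (nagata_over n m).
Proof.
case: m n => a x [_ y] /= ->; split=> [|[c z] _].
  apply: mem_nagata; rewrite /= (rresMP hB) ract_lact_point (lactA hB).
  by apply: le_trans (lact_lresS (x `|` lact B a 0) y); rewrite (lactU hB) leUr.
rewrite !leEprod /= (rresSP hB) (lresSP hB) (rresMP hB) (lactU hB) !leUx.
by rewrite -hcyc (lactA hB) [LHS]andbC [in LHS]andbA [LHS]andbC.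
Qed.

(** Both joinands [(a * 0) * b] and [a * (b * 0)] equal [(a b) * 0]. *)
Lemma nagata_eS_mul (a b : S) :
  nagata_eS B (mul a b) = nagata_mul mul B (nagata_eS B a) (nagata_eS B b).
Proof. by rewrite /nagata_eS /nagata_mul /= ract_lact_point -(lactA hB) joinxx. Qed.

(** The joinand [(a * 0) * (0 \_r x) = a * (0 * (0 \_r x))] is absorbed by [a * x]. *)
Lemma nagata_gamma_lact (a : S) (x : M) :
  nagata_gamma B (nagata_mul mul B (nagata_eS B a) (nagata_eM B x))
    = nagata_eM B (lact B a x).
Proof.
congr nagata_eM; apply/join_idPr.
by rewrite /= (lractA hB) (lact_isotone hB) ?ract_rresS.
Qed.

(** By cyclicity [(0 \_r x) * (a * 0) = ((0 \_r x) * 0) * a], which is absorbed by [x * a]. *)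
Lemma nagata_gamma_ract (a : S) (x : M) :
  nagata_gamma B (nagata_mul mul B (nagata_eM B x) (nagata_eS B a))
    = nagata_eM B (ract B x a).
Proof.
congr nagata_eM; apply/join_idPl.
by rewrite /= hcyc -(lractA hB) (ract_isotone hB) ?lact_rresS_point.
Qed.

(** Since [(0 \_r x) * 0 <= x], the join inside the residual collapses to [x]. *)
Lemma nagata_sigma_under (x y : M) :
  nagata_sigma B (nagata_under (nagata_eM B x) (nagata_eM B y))
    = nagata_eS B (rresS B x y).
Proof. by rewrite /nagata_sigma /= (join_idPl _) ?lact_rresS_point. Qed.

Lemma nagata_sigma_over (x y : M) :
  nagata_sigma B (nagata_over (nagata_eM B y) (nagata_eM B x))
    = nagata_eS B (lresS B y x).
Proof. by rewrite /nagata_sigma /= (join_idPl _) ?lact_rresS_point. Qed.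

End NagataResiduals.

Theorem mainTheorem5
    (dS : Order.disp_t) (S : porderType dS) (mul : S -> S -> S)
    (dM : Order.disp_t) (M : joinSemilatticeType dM)
    (B : bimodule_ops S M)
    (hS : is_posemigroup mul)
    (hB : is_residuated_bimodule mul (@Order.join dM M) B)
    (hcyc : is_cyclic B)
    (N : set (S *p M))
    (hN : N = nagata S M \/ N = restricted_nagata B) :
  let mulN := nagata_mul mul B in
  let sigma := nagata_sigma B in
  let gamma := nagata_gamma B in
  let Nsigma : set (S *p M) := sigma @` N in
  let Ngamma : set (S *p M) := gamma @` N in
  Nsigma `<=` N /\ Ngamma `<=` N /\
  exists (mul' : Nsigma -> Nsigma -> Nsigma) (join' : Ngamma -> Ngamma -> Ngamma)
         (B' : bimodule_ops Nsigma Ngamma)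
         (under over : S *p M -> S *p M -> S *p M)
         (eS : S -> Nsigma) (eM : M -> Ngamma),
    (* Nsigma is a subposemigroup of N *)
    (forall a b : Nsigma, val (mul' a b) = mulN (val a) (val b)) /\
    is_posemigroup mul' /\
    is_join_semilattice join' /\
    (* the residuals m\n and n/m exist in N for n in Ngamma *)
    (forall m n, N m -> Ngamma n ->
      is_nagata_under mul B N m n (under m n) /\
      is_nagata_over mul B N n m (over n m)) /\
    (* Ngamma is a residuated Nsigma-bimodule under the given operations *)
    is_residuated_bimodule mul' join' B' /\
    (forall (a : Nsigma) (x y : Ngamma),
      val (lact B' a x) = gamma (mulN (val a) (val x)) /\
      val (ract B' x a) = gamma (mulN (val x) (val a)) /\
      val (rresS B' x y) = sigma (under (val x) (val y)) /\
      val (lresM B' a x) = gamma (under (val a) (val x)) /\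
      val (lresS B' y x) = sigma (over (val y) (val x)) /\
      val (rresM B' x a) = gamma (over (val x) (val a))) /\
    val (bpoint B') = nagata_eM B (bpoint B) /\
    (* eS and eM are the corestrictions of the maps e_S and e_M *)
    (forall a : S, val (eS a) = nagata_eS B a) /\
    (forall x : M, val (eM x) = nagata_eM B x) /\
    is_bimodule_iso mul (@Order.join dM M) B mul' join' B' eS eM.
Proof.
move=> mulN sigma gamma Nsigma Ngamma.
have N_eS a : N (nagata_eS B a) by apply: (mem_nagata hcyc hN).
have N_eM x : N (nagata_eM B x).
  by apply: (mem_nagata hcyc hN); apply: (lact_rresS_point hB hcyc).
(* Elements [e_S a] are fixed by [sigma], and [e_M x] by [gamma], so each is its own preimage. *)
have Nsigma_eS a : Nsigma (nagata_eS B a) by exists (nagata_eS B a).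
have Ngamma_eM x : Ngamma (nagata_eM B x) by exists (nagata_eM B x).
pose eS a : Nsigma := exist _ (nagata_eS B a) (mem_set (Nsigma_eS a)).
pose eM x : Ngamma := exist _ (nagata_eM B x) (mem_set (Ngamma_eM x)).
pose eS' (a : Nsigma) := (val a).1.
pose eM' (x : Ngamma) := (val x).2.
have eSK : cancel eS eS' by [].
have eMK : cancel eM eM' by [].
have eS'K : cancel eS' eS.
  move=> a; apply: val_inj; have [p _ e] := set_mem (valP a).
  by rewrite -[RHS]e /eS' /eM' -e.
have eM'K : cancel eM' eM.
  move=> x; apply: val_inj; have [p _ e] := set_mem (valP x).
  by rewrite -[RHS]e /eS' /eM' -e.
have eS_le : {mono eS : a b / a <= b}.
  move=> a b; rewrite -[LHS]/(nagata_eS B a <= nagata_eS B b) leEprod /=.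
  by apply: andb_idr => ab; apply: (lact_isotone hB).
have eM_le : {mono eM : x y / x <= y}.
  move=> x y; rewrite -[LHS]/(nagata_eM B x <= nagata_eM B y) leEprod /=.
  (* The first coordinates compare because [0 * (0 \_r x) <= x <= y]. *)
  apply: andb_idl => xy; rewrite (rresSP hB).
  by apply: le_trans xy; apply: (ract_rresS hB).
have Nsigma_val a : val a = nagata_eS B (eS' a) by rewrite -{1}[a]eS'K.
have Ngamma_val x : val x = nagata_eM B (eM' x) by rewrite -{1}[x]eM'K.
split; first by move=> _ [p _ <-]; apply: N_eS.
split; first by move=> _ [p _ <-]; apply: N_eM.
exists (fun a b => eS (mul (eS' a) (eS' b))), (fun x y => eM (eM' x `|` eM' y)).
exists (transport_bimodule eS eS' eM eM' B), (nagata_under B), (nagata_over B), eS, eM.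
split; first by move=> a b; rewrite /mulN !Nsigma_val -(nagata_eS_mul hB hcyc).
split; first exact: transport_posemigroup.
split; first by apply: transport_join_semilattice => // x y z; rewrite leUx.
split.
  move=> m _ _ [p _ <-]; split.
  - exact: (nagata_underP hB hcyc hN).
  - exact: (nagata_overP hB hcyc hN).
split; first exact: transport_residuated_bimodule.
split.
  move=> a x y; rewrite /mulN /sigma /gamma.
  rewrite (Nsigma_val a) (Ngamma_val x) (Ngamma_val y).
  rewrite (nagata_gamma_lact hB) (nagata_gamma_ract hB hcyc).
  (* The identities for [lresM] and [rresM] hold by computation: [gamma] keeps only the second
     coordinate of the residual. *)
  by rewrite (nagata_sigma_under hB hcyc) (nagata_sigma_over hB hcyc).
do 3![split=> //].
exact: transport_bimodule_iso.
Qed.
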